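(* For all integers $n\ge 0$ and $k\ge 2$, $M_k(n)\le \big((k+1)!\big)^{n/(k+1)}$, where $M_k(n)$ is the maximum number of directed cycles in a digraph with $n$ vertices, without multi-edges (self-loops allowed), in which every vertex has outdegree at most $k$.
   Context: A digraph is a finite directed graph, possibly with self-loops. $\mathcal G_{\text{simple}}^{n,k}$ is the set of all digraphs with $n$ vertices, outdegree at most $k$ at every vertex, and no multi-edges (i.e. at most one edge for each ordered pair $(u,v)$; self-loops $(u,u)$ are allowed and count towards the outdegree; both $(u,v)$ and $(v,u)$ may be present). A cycle is a directed cycle (no repeated vertices; a self-loop is a cycle of length 1, and 2-cycles $u\to v\to u$ count). $C(G)$ is the number of cycles of $G$ (as subgraphs), and $M_k(n)=\max_{G\in\mathcal G_{\text{simple}}^{n,k}}C(G)$. *)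

(* Defs.v *)
From HB Require Import structures.
From mathcomp Require Import all_boot all_order all_algebra.
From mathcomp Require Import reals exp.

Set Implicit Arguments.
Unset Strict Implicit.
Unset Printing Implicit Defensive.

Section Digraph.
Variable V : finType.

(* The digraph on V is its set of edges (u, v): self-loops are allowed, and
   multi-edges are excluded by the encoding. *)
Definition digraph := {set V * V}.

Definition edge (G : digraph) : rel V := fun u v => (u, v) \in G.

Definition outdeg (G : digraph) (u : V) : nat := #|[set v | edge G u v]|.

(* The edges x_1 -> x_2 -> ... -> x_m -> x_1 of the closed walk s; all
   rotations of s have the same edge set when s is duplicate-free. *)
Definition cycle_edges (s : seq V) : {set V * V} :=
  [set (x, next s x) | x in s].

(* Cycles as subgraphs of G, identified with their (nonempty) edge sets.
   A duplicate-free sequence has at most #|V| entries, so ranging over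
   sequences of length at most #|V| loses no cycle. *)
Definition cycles (G : digraph) : {set {set V * V}} :=
  [set cycle_edges s | s : #|V|.-bseq V & (s != [::] :> seq V) && ucycleb (edge G) s].

Definition num_cycles (G : digraph) : nat := #|cycles G|.

End Digraph.

(* M k n is M_k(n), with vertex set 'I_n; the maximum is over a nonempty
   family, since it contains the edgeless digraph. *)
Definition M (k n : nat) : nat :=
  \max_(G : digraph 'I_n | [forall u, outdeg G u <= k]) num_cycles G.

(* Main.v *)
(* A cycle of length at least 2 extends by fixed points to a nontrivial
   permutation p with p x in {x} U N(x) for all x, and distinct cycles give
   distinct permutations.  With l self-loops, C(G) <= l + P - 1, where P is the
   permanent of the adjacency matrix with ones on the diagonal.  A looped vertex
   has row sum at most k and any other at most k + 1, so Bregman's inequality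
   (in Schrijver's proof, by logarithms) gives P <= a^l b^(n-l) for
   a = (k!)^(1/k) and b = ((k+1)!)^(1/(k+1)).  The l extra cycles are absorbed by
   the gap between a and b: a^l b^(n-l) + l - 1 <= b^n. *)
Require Import Defs.
From mathcomp Require Import all_boot all_order all_algebra fingroup perm.
From mathcomp Require Import reals sequences exp.
From mathcomp Require Import zify ring lra.

Set Implicit Arguments.
Unset Strict Implicit.
Unset Printing Implicit Defensive.

Import Order.TTheory GRing.Theory Num.Theory.

Local Open Scope ring_scope.

(** * Permutations supported on a 0-1 matrix *)

Section SupportedPermutations.
Variable V : finType.
Implicit Type E : V -> {set V}.

Definition supported_perms E : {set {perm V}} :=
  [set p : {perm V} | [forall x, p x \in E x]].

(* Plays the role of the minor of row i and column c, keeping the index type V: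
   the entry c is forced in row i and removed from every other row. *)
Definition fix_entry E (i c : V) : V -> {set V} :=
  fun j => if j == i then [set c] else E j :\ c.

Lemma supported_permP E (p : {perm V}) :
  reflect (forall x, p x \in E x) (p \in supported_perms E).
Proof. by rewrite inE; apply: forallP. Qed.

Lemma supported_perms_fix_entry E i c : c \in E i ->
  supported_perms (fix_entry E i c) = [set p in supported_perms E | p i == c].
Proof.
move=> cE; apply/setP => p; rewrite [RHS]inE.
apply/supported_permP/andP => [pE|[/supported_permP pE /eqP pi] x].
  have pi : p i = c by have := pE i; rewrite /fix_entry eqxx inE => /eqP.
  split; last by rewrite pi.
  apply/supported_permP => x; have := pE x; rewrite /fix_entry.
  by case: eqP => [->|_]; [rewrite pi | rewrite inE => /andP[]].
rewrite /fix_entry; case: eqP => [->|/eqP xi]; first by rewrite pi inE.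
by rewrite !inE pE -pi (inj_eq perm_inj) xi.
Qed.

Lemma supported_perms_singletons E :
  (forall x, (#|E x| <= 1)%N) -> (#|supported_perms E| <= 1)%N.
Proof.
move=> E1; apply/card_le1_eqP => p q /supported_permP pE /supported_permP qE.
by apply/permP => x; have /card_le1_eqP := E1 x; apply.
Qed.

End SupportedPermutations.

(** * Bregman's inequality in logarithmic form *)

Section Bregman.
Variable R : realType.
Variable V : finType.
Implicit Type E : V -> {set V}.

(** The logarithm of Bregman's factor for a row with r ones; division by zero makes it 0 at r =
    0. *)
Definition log_fact_root (r : nat) : R := ln r`!%:R / r%:R.
Local Notation phi := log_fact_root.

Lemma log_fact_root1 : phi 1 = 0.
Proof. by rewrite /phi ln1 mul0r. Qed.

Lemma mul_log_fact_root r : r%:R * phi r = ln r`!%:R.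
Proof.
case: r => [|r]; first by rewrite mul0r ln1.
by rewrite mulrC divfK ?pnatr_eq0.
Qed.

Lemma ln_factS r : ln r.+1`!%:R = ln r.+1%:R + ln r`!%:R :> R.
Proof. by rewrite factS natrM lnM ?posrE ?ltr0n ?fact_gt0. Qed.

Lemma ln_fact_le r : ln r`!%:R <= r%:R * ln r.+1%:R :> R.
Proof.
elim: r => [|r IHr]; first by rewrite ln1 mul0r.
rewrite ln_factS -[in r.+1%:R * _]natr1 mulrDl mul1r addrC lerD //.
  apply: le_trans IHr _; apply: ler_wpM2l; first exact: ler0n.
  by rewrite ler_ln ?posrE ?ltr0n // ler_nat.
by rewrite ler_ln ?posrE ?ltr0n // ler_nat.
Qed.

(** With denominators cleared, consecutive values compare by ln r! <= r ln (r + 1). *)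
Lemma log_fact_root_homo : {homo phi : r s / (r <= s)%N >-> r <= s}.
Proof.
apply: homo_leq => [//|x y z|r]; first exact: le_trans.
case: r => [|r]; first by rewrite log_fact_root1 /phi invr0 mulr0.
rewrite /phi ler_pdivrMr ?ltr0n // mulrAC ler_pdivlMr ?ltr0n //.
rewrite [in leRHS]ln_factS -[in leLHS]natr1.
by have := ln_fact_le r.+1; lra.
Qed.

(* The terms with x c = 0 vanish as 0 * ln 0 = 0. *)
Lemma xlnx_jensen (I : finType) (A : {set I}) (x : I -> nat) (P : nat) :
  (0 < P)%N -> (\sum_(c in A) x c)%N = P ->
  P%:R * ln P%:R <= P%:R * ln #|A|%:R + \sum_(c in A) (x c)%:R * ln (x c)%:R :> R.
Proof.
move=> P0 sumP.
have A0 : (0 < #|A|)%N.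
  rewrite lt0n; apply: contraTneq P0 => /eqP; rewrite cards_eq0 => /eqP A0.
  by rewrite -sumP A0 big_set0.
have posP : (0 : R) < P%:R by rewrite ltr0n.
have posA : (0 : R) < #|A|%:R by rewrite ltr0n.
have : \sum_(c in A) ((x c)%:R * (ln P%:R - ln #|A|%:R) - (x c)%:R * ln (x c)%:R)
   <= \sum_(c in A) (P%:R / #|A|%:R - (x c)%:R) :> R.
  apply: ler_sum => c _; have [->|x0] := posnP (x c).
    by rewrite !mul0r !subr0 divr_ge0.
  have posx : (0 : R) < (x c)%:R by rewrite ltr0n.
  rewrite -mulrBr -!ln_div ?posrE ?divr_gt0 //.
  have -> : P%:R / #|A|%:R - (x c)%:R = (x c)%:R * (P%:R / #|A|%:R / (x c)%:R - 1) :> R.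
    by rewrite mulrBr mulr1 [(x c)%:R * _]mulrC divfK ?gt_eqF.
  rewrite ler_pM2l //.
  (* ln t <= t - 1 at t = P / (#|A| x c); summed over [A], the right-hand sides cancel. *)
  have := @le_ln1Dx R (P%:R / #|A|%:R / (x c)%:R - 1).
  rewrite [1 + _]addrC subrK; apply.
  by rewrite ltrBrDl subrr !divr_gt0.
rewrite !sumrB -mulr_suml -natr_sum sumP sumr_const -[(_ / _) *+ _]mulr_natr.
rewrite divfK ?gt_eqF //.
rewrite subrr mulrBr; set s := \sum_(_ in _) _; lra.
Qed.

(** Expansion along row [i]: the permutations split by the value p i, and [xlnx_jensen] applies to
    the class sizes; a class of size x contributes x ln x to the sum over p. *)
Lemma supported_perms_entropy E i : (0 < #|supported_perms E|)%N ->
  #|supported_perms E|%:R * ln #|supported_perms E|%:R <=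
  \sum_(p in supported_perms E)
    (ln #|E i|%:R + ln #|supported_perms (fix_entry E i (p i))|%:R) :> R.
Proof.
move=> P0; set x := fun c => #|supported_perms (fix_entry E i c)|.
have xE c : c \in E i -> x c = (\sum_(p in supported_perms E | p i == c) 1)%N.
  move=> cE; rewrite /x supported_perms_fix_entry // -sum1_card.
  by apply: eq_bigl => p; rewrite inE.
have sumP : (\sum_(c in E i) x c)%N = #|supported_perms E|.
  rewrite -sum1_card (partition_big (fun p : {perm V} => p i) (mem (E i))) /=.
    exact: eq_bigr.
  by move=> p /supported_permP.
apply: le_trans (xlnx_jensen P0 sumP) _; rewrite big_split /= lerD //.
  by rewrite sumr_const mulr_natl.
rewrite [leRHS](partition_big (fun p : {perm V} => p i) (mem (E i))) /=; last first.
  by move=> p /supported_permP.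
apply: ler_sum => c cE; rewrite (eq_bigr (fun=> ln (x c)%:R)); last first.
  by move=> p /andP[_ /eqP->].
by rewrite big_const_seq /= iter_addr_0 mulr_natl xE // sum1_count.
Qed.

(* As singleton rows have phi 1 = 0, averaging only over the other rows still
   gives an equality, provided the columns of the singleton rows meet no other
   row. *)
Lemma bregman_average E (p : {perm V}) (D := [set i | (1 < #|E i|)%N]) :
  p \in supported_perms E ->
  (forall i j, i != j -> i \notin D -> p i \notin E j) ->
  \sum_(i in D) (ln #|E i|%:R + \sum_j phi #|fix_entry E i (p i) j|) =
  #|D|%:R * \sum_j phi #|E j|.
Proof.
move=> /supported_permP pE isoE.
rewrite big_split /= exchange_big /= mulr_sumr big_mkcond -big_split /=.
apply: eq_bigr => j _.
have cardE i : i != j ->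
    #|fix_entry E i (p i) j| = if p i \in E j then #|E j|.-1 else #|E j|.
  move=> ij; rewrite /fix_entry eq_sym (negbTE ij) (cardsD1 (p i) (E j)).
  by case: (p i \in E j).
case: ifPn => jD; last first.
  have Ej : #|E j| = 1%N.
    move: jD; rewrite inE -leqNgt => Ej; apply/eqP; rewrite eqn_leq Ej.
    by apply/card_gt0P; exists (p j).
  rewrite Ej log_fact_root1 mulr0 add0r big1 // => i iD.
  have ij : i != j by apply: contraNneq jD => <-.
  rewrite cardE // ifN ?Ej ?log_fact_root1 //.
  move/eqP: Ej => /cards1P[c Ec].
  have := pE j; rewrite Ec !inE => /eqP<-.
  by rewrite (inj_eq perm_inj).
have Ej : (1 < #|E j|)%N by move: jD; rewrite inE.
(* All the indices that [p] sends into [E j] lie in [D], by the isolation hypothesis. *)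
have cardD : #|[set i in D | p i \in E j]| = #|E j|.
  rewrite -(card_preimset (E j) (@perm_inj _ p)).
  apply: eq_card => i; rewrite !inE; case: (boolP (p i \in E j)) => [piE|]; last by rewrite andbF.
  rewrite andbT; apply: contraTT piE => iD.
  by apply: isoE; rewrite ?inE //; apply: contraNneq iD => ->.
(* [F] agrees with the true summand except at i = j, where size 1 becomes #|E j| - 1; its sum over
   all of [D] is then explicit. *)
pose F i := phi #|E j| + (if p i \in E j then phi #|E j|.-1 - phi #|E j| else 0).
have sumF : \sum_(i in D) F i =
    #|D|%:R * phi #|E j| + #|E j|%:R * (phi #|E j|.-1 - phi #|E j|).
  rewrite big_split /= sumr_const mulr_natl -big_mkcondr /=; congr (_ + _).
  set d := phi _ - phi _; rewrite -cardD mulr_natl -sumr_const.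
  by apply: eq_bigl => i; rewrite [RHS]inE.
move: sumF; rewrite (bigD1 j jD) /= => sumF.
rewrite (bigD1 j jD) /= {1}/fix_entry eqxx cards1 log_fact_root1 add0r.
have -> : \sum_(i in D | i != j) phi #|fix_entry E i (p i) j| = \sum_(i in D | i != j) F i.
  apply: eq_bigr => i /andP[_ ij]; rewrite cardE // /F.
  by case: ifP; rewrite ?addr0 // addrC subrK.
move: sumF; rewrite /F pE; case: (#|E j|) Ej => // m _ /= sumF.
(* With r = #|E j|, what remains is ln r + (r - 1) phi (r - 1) = r phi r. *)
have := mul_log_fact_root m; have := mul_log_fact_root m.+1.
rewrite ln_factS -natr1 in sumF *; lra.
Qed.

(** Induction on the number of allowed entries. If the entry of a singleton row also occurs in
    another row, deleting it there loses no permutation and does not raise the bound. Otherwise the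
    entropy bound is summed over the rows with at least two entries, the minors are bounded by
    induction, and [bregman_average] evaluates the result for each permutation. *)
Lemma bregman E : (0 < #|supported_perms E|)%N ->
  ln #|supported_perms E|%:R <= \sum_j phi #|E j| :> R.
Proof.
have [m] := ubnP (\sum_j #|E j|)%N; elim: m E => // m IHm E; rewrite ltnS => leEm P0.
have [q qS] := card_gt0P P0; have /supported_permP qE := qS.
have fix_sum i c : c \in E i -> (1 < #|E i|)%N || [exists j, (j != i) && (c \in E j)] ->
    (\sum_j #|fix_entry E i c j| < m)%N.
  move=> ci strict; apply: leq_trans leEm.
  have le_fix j : (#|fix_entry E i c j| <= #|E j|)%N.
    rewrite /fix_entry; case: eqP => [->|_]; last by rewrite subset_leq_card ?subD1set.
    by rewrite cards1; apply/card_gt0P; exists c.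
  have [j lt_fix] : exists j, (#|fix_entry E i c j| < #|E j|)%N.
    case/orP: strict => [Ei|/existsP[j /andP[ji cj]]].
      by exists i; rewrite /fix_entry eqxx cards1.
    by exists j; rewrite /fix_entry (negbTE ji) [ltnRHS](cardsD1 c) cj.
  rewrite (bigD1 j) //= [ltnRHS](bigD1 j) //= -addSn leq_add //.
  exact: leq_sum.
pose D := [set i | (1 < #|E i|)%N].
case: (boolP [exists i, exists j, [&& i != j, i \notin D & q i \in E j]]) => [|noX].
  move=> /existsP[i /existsP[j /and3P[ij iD qij]]].
  have Ei : E i = [set q i].
    move: iD; rewrite inE -leqNgt => Ei; apply/eqP; rewrite eq_sym eqEcard.
    by rewrite sub1set qE cards1.
  have S_eq : supported_perms (fix_entry E i (q i)) = supported_perms E.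
    rewrite supported_perms_fix_entry //; apply/setP => p; rewrite inE.
    case: (boolP (p \in _)) => //= /supported_permP /(_ i).
    by rewrite Ei inE.
  rewrite -S_eq; apply: le_trans (IHm _ _ _) _; last 1 first.
  - apply: ler_sum => k _; apply: log_fact_root_homo.
    rewrite /fix_entry; case: eqP => [->|_]; first by rewrite Ei.
    by rewrite subset_leq_card ?subD1set.
  - apply: fix_sum => //; apply/orP; right; apply/existsP; exists j.
    by rewrite eq_sym ij.
  - by rewrite S_eq.
have isoE p : p \in supported_perms E ->
    forall i j, i != j -> i \notin D -> p i \notin E j.
  move=> /supported_permP pE i j ij iD; move: (iD); rewrite inE -leqNgt => /card_le1_eqP Ei.
  apply: contraNN noX => pij; apply/existsP; exists i; apply/existsP; exists j.
  by rewrite ij iD -(Ei _ _ (qE i) (pE i)) pij.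
have phi_ge0 j : 0 <= phi #|E j|.
  by rewrite divr_ge0 // ln_ge0 // ler1n fact_gt0.
have [D0|D0] := posnP #|D|.
  apply: le_trans (sumr_ge0 _ (fun j _ => phi_ge0 j)).
  rewrite ln_le0 // lern1 supported_perms_singletons // => x.
  have : x \notin D by rewrite (cards0_eq D0) inE.
  by rewrite inE -leqNgt.
have posD : (0 : R) < #|D|%:R by rewrite ltr0n.
have posP : (0 : R) < #|supported_perms E|%:R by rewrite ltr0n.
rewrite -(ler_pM2l posD) -(ler_pM2l posP) mulrCA mulr_natl -sumr_const.
have : \sum_(i in D) #|supported_perms E|%:R * ln #|supported_perms E|%:R <=
    \sum_(i in D) \sum_(p in supported_perms E)
      (ln #|E i|%:R + ln #|supported_perms (fix_entry E i (p i))|%:R) :> R.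
  by apply: ler_sum => i _; apply: supported_perms_entropy.
rewrite exchange_big /= => /le_trans; apply.
rewrite mulr_natl -sumr_const; apply: ler_sum => p pS.
have /supported_permP pE := pS.
rewrite -(bregman_average pS (isoE p pS)); apply: ler_sum => i iD.
rewrite lerD2l; apply: IHm.
  by rewrite fix_sum //; move: iD; rewrite inE => ->.
by rewrite supported_perms_fix_entry //; apply/card_gt0P; exists p; rewrite inE pS eqxx.
Qed.

End Bregman.

(** * From cycles to supported permutations *)

Section CyclesAsPermutations.
Variable V : finType.
Implicit Type G : digraph V.

Definition reflexive_succs G (u : V) : {set V} := u |: [set v | edge G u v].

Definition loops G : {set V} := [set u | edge G u u].

Definition moved_edges (p : {perm V}) : {set V * V} :=
  [set (x, p x) | x in [set x | p x != x]].

Lemma next_neq (s : seq V) x : uniq s -> (1 < size s)%N -> x \in s -> next s x != x.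
Proof.
move=> Us s1 /rot_to[i s' rs]; rewrite -(next_rot i Us) rs.
have := Us; rewrite -(rot_uniq i) rs; move: s1; rewrite -(size_rot i) rs.
case: s' {rs} => //= y s' _ /andP[]; rewrite inE negb_or eqxx => /andP[xy _] _.
by rewrite eq_sym.
Qed.

Lemma cycles_sub G :
  cycles G \subset [set [set (u, u)] | u in loops G] :|:
    [set moved_edges p | p in supported_perms (reflexive_succs G) :\ 1%g].
Proof.
apply/subsetP => X /imsetP[[s sV]]; rewrite inE /= => /andP[s0 /andP[Gs Us]] ->.
have [s1|s1] := leqP (size s) 1.
  case: s s0 s1 Gs {sV Us} => [|u [|]] //= _ _; rewrite andbT => Guu.
  rewrite inE; apply/orP; left; apply/imsetP; exists u; first by rewrite inE.
  apply/setP => e; rewrite inE; apply/imsetP/eqP => [[x]|->].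
    by rewrite inE => /eqP-> ->; rewrite /= eqxx.
  by exists u; rewrite ?inE //= eqxx.
rewrite inE; apply/orP; right.
(* [next s] fixes every point outside [s] by default, so it is already the extension by fixed
   points. *)
pose p := perm (can_inj (prev_next Us)).
have moved x : (p x != x) = (x \in s).
  rewrite permE; case: (boolP (x \in s)) => xs; first by rewrite next_neq.
  by rewrite next_nth (negbTE xs) eqxx.
apply/imsetP; exists p.
  rewrite 2!inE; apply/andP; split.
    have [u us] : exists u, u \in s.
      by case: s s0 {sV s1 Gs Us p moved} => // u s' _; exists u; rewrite mem_head.
    by apply: contraTneq us => p1; rewrite -moved p1 perm1 eqxx.
  apply/supported_permP => x; rewrite !inE.
  by case: eqVneq => //=; rewrite moved permE => /next_cycle; apply.
apply/setP => e; apply/imsetP/imsetP => -[x xs ->]; exists x; rewrite ?permE //.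
  by rewrite inE moved.
by move: xs; rewrite inE moved.
Qed.

Lemma num_cycles_le G :
  (num_cycles G <= #|loops G| + #|supported_perms (reflexive_succs G)|.-1)%N.
Proof.
have id_supp : 1%g \in supported_perms (reflexive_succs G).
  by apply/supported_permP => x; rewrite perm1 setU11.
rewrite (cardsD1 1%g) id_supp; apply: leq_trans (subset_leq_card (cycles_sub G)) _.
by apply: leq_trans (leq_card_setU _ _) _; rewrite leq_add ?leq_imset_card.
Qed.

Lemma card_reflexive_succs G k u : (outdeg G u <= k)%N ->
  (#|reflexive_succs G u| <= if u \in loops G then k else k.+1)%N.
Proof.
rewrite /outdeg cardsU1 !inE => Gu.
by case: (edge G u u); rewrite ?add0n ?add1n.
Qed.

End CyclesAsPermutations.

(** * Estimates for roots of factorials *)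

Section FactorialRoots.
Variable R : realType.
Local Notation phi := (@log_fact_root R).

(** Pair the factors i + 1 and k - i of the two factorials: for i < k their product is at least
    k. *)
Lemma leq_exp_fact_sqr k : (k ^ k <= k`! ^ 2)%N.
Proof.
have factE : k`! = (\prod_(i < k) i.+1)%N by rewrite fact_prod big_add1 big_mkord.
rewrite -mulnn {1}factE (reindex_inj rev_ord_inj) /= factE -big_split /=.
rewrite -{1 2}[k]card_ord -prod_nat_const.
by apply: leq_prod => i _; have := ltn_ord i; rewrite card_ord; nia.
Qed.

(** Bernoulli's inequality for (1 + 1/m)^j, cleared of denominators. *)
Lemma bernoulli_nat m j : (m ^ j * (m + j) <= m * m.+1 ^ j)%N.
Proof.
elim: j => [|j IHj]; first by rewrite !expn0 addn0 mulnC.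
rewrite !expnS; set x := (m ^ j)%N in IHj *; set y := (m.+1 ^ j)%N in IHj *; nia.
Qed.

(** The induction step is 2 (k + 1)^(k + 1) <= (k + 2)^(k + 1), Bernoulli with m = j = k + 1. *)
Lemma exp2_fact_leq k : (2 ^ k * k`! <= k.+1 ^ k)%N.
Proof.
elim: k => // k IHk; rewrite factS !expnS.
have := bernoulli_nat k.+1 k.+1; rewrite !expnS.
move: IHk; set x := (2 ^ k)%N; set y := (k.+1 ^ k)%N; set z := (k.+2 ^ k)%N.
set f := k`! => IHk H.
have : (2 * (k.+1 * y) <= k.+2 * z)%N.
  by rewrite -(leq_pmul2l (ltn0Sn k)) (leq_trans _ H) //; lia.
by apply: leq_trans; nia.
Qed.

(** With t = m x, the induction step needs (3/4) t^2 x <= (1/2) t x, whence the threshold 2/3. *)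
Lemma exp1D_le (x : R) m : 0 <= x -> m%:R * x <= 2 / 3 ->
  (1 + x) ^+ m <= 1 + m%:R * x + 3 / 4 * (m%:R * x) ^+ 2.
Proof.
move=> x0; elim: m => [|m IHm]; first by rewrite expr0 !mul0r expr0n /=; lra.
rewrite -natr1 mulrDl mul1r => mx; rewrite exprSr.
have m0 : 0 <= m%:R * x :> R by rewrite mulr_ge0.
have {}IHm : (1 + x) ^+ m <= 1 + m%:R * x + 3 / 4 * (m%:R * x) ^+ 2.
  by apply: IHm; lra.
apply: le_trans (ler_wpM2r _ IHm) _; first by lra.
set t := m%:R * x in mx m0 *.
have tt : t * t <= 2 / 3 * t by apply: ler_wpM2r => //; lra.
have := ler_wpM2l x0 tt.
have : 0 <= x * t by rewrite mulr_ge0.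
by have : 0 <= x * x := mulr_ge0 x0 x0; lra.
Qed.

Lemma exp1D_half_le2 k : (2 <= k)%N -> (1 + (2 * k%:R)^-1) ^+ k.+1 <= 2 :> R.
Proof.
(* k = 2 is (5/4)^3 = 125/64. For k >= 3, (k + 1) x = 1/2 + x <= 2/3, and [exp1D_le] gives at most 1
   + 2/3 + 1/3 = 2. *)
case: k => [|[|[|k]]] // _; first by rewrite !exprS expr0; lra.
set x := (2 * _)^-1.
have kx : k.+3%:R * x = 2^-1 by rewrite /x invfM mulrCA mulfV ?mulr1 ?pnatr_eq0.
have x0 : 0 <= x by rewrite invr_ge0 mulr_ge0.
have x6 : x <= 6^-1.
  by rewrite /x lef_pV2 ?posrE ?mulr_gt0 ?ltr0n //; have := ler0n R k; lra.
have kx1 : k.+4%:R * x = 2^-1 + x by rewrite -kx -[k.+4%:R]natr1; ring.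
apply: le_trans (exp1D_le x0 _) _; rewrite kx1; first by lra.
by nra.
Qed.

Lemma fact_root_expn k : expR (phi k) ^+ k = k`!%:R.
Proof. by rewrite -expRM_natl mul_log_fact_root lnK // posrE ltr0n fact_gt0. Qed.

Lemma fact_root_sqr_ge k : (0 < k)%N -> k%:R <= expR (phi k) ^+ 2.
Proof.
move=> k0; rewrite -(ler_pXn2r k0) ?nnegrE ?exprn_ge0 ?expR_ge0 //.
by rewrite exprAC fact_root_expn -!natrX ler_nat leq_exp_fact_sqr.
Qed.

Lemma fact_root_le k : (0 < k)%N -> 2 * expR (phi k) <= k.+1%:R.
Proof.
move=> k0; rewrite -(ler_pXn2r k0) ?nnegrE ?mulr_ge0 ?expR_ge0 //.
by rewrite exprMn fact_root_expn -!natrX -natrM ler_nat exp2_fact_leq.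
Qed.

(* b ^ (k + 1) = (k + 1) a ^ k >= 2 a ^ (k + 1), while
   (1 + 1 / (2 a ^ 2)) ^ (k + 1) <= (1 + 1 / (2 k)) ^ (k + 1) <= 2. *)
Lemma fact_root_gap k (a := expR (phi k)) (b := expR (phi k.+1)) :
  (2 <= k)%N -> 1 <= 2 * a * (b - a).
Proof.
move=> k2; have k0 : (0 < k)%N by apply: leq_trans k2.
have a0 : 0 < a by apply: expR_gt0.
have ak : k%:R <= a ^+ 2 by apply: fact_root_sqr_ge.
pose y := (2 * a ^+ 2)^-1.
have y0 : 0 <= y by rewrite invr_ge0 mulr_ge0 ?exprn_ge0 ?ltW.
have y1 : (1 + y) ^+ k.+1 <= 2.
  apply: le_trans (exp1D_half_le2 k2).
  have yk : y <= (2 * k%:R)^-1.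
    by rewrite lef_pV2 ?posrE ?mulr_gt0 ?exprn_gt0 ?ltr0n // ler_pM2l.
  by rewrite lerXn2r ?nnegrE ?lerD2l // addr_ge0 // (le_trans y0).
have ab : a * (1 + y) <= b.
  rewrite -(ler_pXn2r (ltn0Sn k)) ?nnegrE ?mulr_ge0 ?addr_ge0 ?expR_ge0 //.
  rewrite exprMn [leRHS]fact_root_expn factS natrM -fact_root_expn -/a.
  rewrite exprS mulrAC ler_pM2r ?exprn_gt0 //.
  apply: le_trans (fact_root_le k0); rewrite -/a mulrC ler_pM2r //.
have ay : 2 * a * (a * y) = 1 by rewrite /y; field; rewrite gt_eqF.
by rewrite -[leLHS]ay ler_pM2l ?mulr_gt0 //; lra.
Qed.

(** A convex power lies above its tangent at [a]; the induction step leaves the excess (j + 1) a^j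
    (b - a)^2. *)
Lemma exprn_tangent (a b : R) j : 0 <= a -> a <= b ->
  a ^+ j.+1 + j.+1%:R * a ^+ j * (b - a) <= b ^+ j.+1.
Proof.
move=> a0 ab; elim: j => [|j IHj]; first by rewrite !expr1 expr0; lra.
rewrite [leRHS]exprS; apply: le_trans (ler_wpM2l _ IHj); last by lra.
rewrite -subr_ge0 -[j.+2%:R]natr1 !exprS.
suff -> : b * (a * a ^+ j + j.+1%:R * a ^+ j * (b - a)) -
   (a * (a * a ^+ j) + (j.+1%:R + 1) * (a * a ^+ j) * (b - a)) =
   j.+1%:R * a ^+ j * (b - a) ^+ 2.
  by rewrite !mulr_ge0 ?exprn_ge0 // subr_ge0.
by ring.
Qed.

Lemma loops_tradeoff (a b : R) l m : 2 <= a ^+ 2 -> 0 <= a -> 1 <= 2 * a * (b - a) ->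
  a ^+ l * b ^+ m + l%:R <= b ^+ (l + m) + 1.
Proof.
move=> a2 a0 gap.
(* 4/3 is what the case l = 3 requires: 3 a / 2 >= 2. *)
have a43 : 4 / 3 <= a.
  by rewrite -(@ler_pXn2r _ 2) ?nnegrE //; lra.
have ab : a <= b.
  by rewrite -subr_ge0 -(@pmulr_rge0 _ (2 * a)); lra.
have b1 : 1 <= b ^+ m by rewrite exprn_ege1 //; lra.
(* Reduction to m = 0, by (b^l - a^l) (b^m - 1) >= 0. *)
suff abl : a ^+ l + l%:R <= b ^+ l + 1.
  have abl' : a ^+ l <= b ^+ l by rewrite lerXn2r ?nnegrE //; lra.
  rewrite exprD -subr_ge0.
  have : 0 <= (b ^+ l - a ^+ l) * (b ^+ m - 1) by rewrite mulr_ge0 ?subr_ge0.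
  by lra.
case: l => [|j]; first by rewrite !expr0; lra.
suff jg : j%:R <= j.+1%:R * a ^+ j * (b - a).
  by have := exprn_tangent j a0 ab; rewrite -[in _ + _%:R]natr1; lra.
case: j => [|j]; first by rewrite mulr_ge0 ?mulr_ge0 ?subr_ge0 ?exprn_ge0.
(* Now l = j + 2. Since a (b - a) >= 1/2, it remains to show (j + 2) a^j / 2 >= j + 1: by a >= 4/3
   for j = 1 and by a^j >= 2 for j >= 2. *)
have : j.+2%:R * a ^+ j / 2 <= j.+2%:R * a ^+ j.+1 * (b - a).
  have := ler_wpM2l (mulr_ge0 (ler0n R j.+2) (exprn_ge0 j a0)) gap.
  by rewrite [a ^+ j.+1]exprS; lra.
apply: le_trans; rewrite ler_pdivlMr //.
case: j => [|[|j]]; first by rewrite expr0; lra.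
  by rewrite expr1; lra.
have aj : 2 <= a ^+ j.+2.
  apply: le_trans a2 _; apply: ler_weXn2l => //; lra.
have := ler_wpM2l (ler0n R j.+4) aj; rewrite -[j.+4%:R]natr1.
lra.
Qed.

End FactorialRoots.

Theorem theorem2 (R : realType) (n k : nat) (hk : (2 <= k)%N) :
  (M k n)%:R <= ((k.+1)`!)%:R `^ (n%:R / (k.+1)%:R) :> R.
Proof.
set a := expR (log_fact_root R k); set b := expR (log_fact_root R k.+1).
have -> : (k.+1)`!%:R `^ (n%:R / (k.+1)%:R) = b ^+ n :> R.
  rewrite /powR pnatr_eq0 gtn_eqF ?fact_gt0 // -expRM_natl.
  by rewrite /log_fact_root -mulrA [_^-1 * _]mulrC.
rewrite /M; elim/big_ind: _ => [|x y|G /forallP Gk].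
- by rewrite exprn_ge0 ?expR_ge0.
- by rewrite /maxn; case: ifP.
pose E := reflexive_succs G; pose P := #|supported_perms E|.
pose l := #|loops G|; pose m := #|~: loops G|.
have lm : (l + m)%N = n by rewrite cardsC card_ord.
have P0 : (0 < P)%N.
  apply/card_gt0P; exists 1%g; apply/supported_permP => x.
  by rewrite perm1 setU11.
have Pab : P%:R <= a ^+ l * b ^+ m.
  rewrite -[P%:R](lnK _) ?posrE ?ltr0n // -!expRM_natl -expRD ler_expR.
  apply: le_trans (bregman R P0) _.
  rewrite (bigID (mem (loops G))) /= !mulr_natl -!sumr_const lerD //.
    apply: ler_sum => u ul; apply: log_fact_root_homo.
    by have := card_reflexive_succs (Gk u); rewrite ul.
  rewrite [leRHS](eq_bigl (fun u => u \notin loops G)); last by move=> u; rewrite inE.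
  apply: ler_sum => u ul; apply: log_fact_root_homo.
  by have := card_reflexive_succs (Gk u); rewrite (negbTE ul).
(* The 1 on the left accounts for the identity, which yields no cycle. *)
have : (num_cycles G)%:R + 1 <= l%:R + P%:R :> R.
  rewrite natr1 -natrD ler_nat -(prednK P0) addnS ltnS.
  exact: num_cycles_le.
have a2 : 2 <= a ^+ 2.
  by apply: le_trans (fact_root_sqr_ge R (ltnW hk)); rewrite ler_nat.
have := loops_tradeoff l m a2 (expR_ge0 _) (fact_root_gap R hk).
by rewrite -/a -/b lm; lra.
Qed.
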